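(* Let $\Phi$ be an approximation of the penalty term $\phi$, let $g_{\lambda}(x) = f(x) + \lambda\phi(x)$ and $F_{\lambda}(x,p) = f(x) + \lambda \Phi(x,p)$, and put $e(p) = \sup_{x \in A} |\Phi(x, p) - \phi(x)|$ for $p \in P$. Let $g_{\lambda_0}$ be bounded below on the set $A$ for some $\lambda_0 \ge 0$. Then for any $\lambda \ge \lambda_0$ and for all $p \in \operatorname{dom} e$ one has $$\Big| \inf_{x \in A} F_{\lambda}(x, p) - \inf_{x \in A} g_{\lambda}(x) \Big| \le \lambda e(p).$$ Furthermore, if the penalty function $g_{\lambda}$ is (globally) exact and $\lambda > \lambda^*(f, \phi)$, then for any $p \in \operatorname{dom} e$ such that the function $F_{\lambda}(\cdot, p)$ attains a global minimum on $A$, and for any global minimizer $x_p$ of $F_{\lambda}(\cdot, p)$ on $A$, one has $$| f^* - f(x_p) | \le \lambda \big( e(p) + \Phi(x_p, p) \big).$$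
   Context: Setting. $X$ is a metric space, $M, A \subset X$ are nonempty, $f \colon X \to \mathbb{R} \cup \{+\infty\}$. The problem $(\mathcal{P})$ is: minimize $f(x)$ subject to $x \in M$, $x \in A$. $\Omega = M \cap A$; it is assumed that $f$ attains a global minimum on $\Omega$, with finite value $f^*$. $\phi \colon X \to [0,+\infty]$ satisfies $\phi(x) = 0$ iff $x \in M$. $P$ is a metric space and $p_0 \in P$ is fixed. Exactness of $g_\lambda$: there exists $\lambda' \ge 0$ such that $g_{\lambda'}$ attains a global minimum on $A$ and $x^*$ is a global minimizer of $g_{\lambda'}$ on $A$ iff $x^*$ is a globally optimal solution of $(\mathcal{P})$; $\lambda^*(f,\phi)$ denotes the infimum of all such $\lambda'$. Approximation: a function $\Phi \colon X \times P \to [0,+\infty]$ is an approximation of $\phi$ if $\Phi(\cdot, p_0) = \phi(\cdot)$ and $\Phi(\cdot, p) \to \phi(\cdot)$ as $p \to p_0$ uniformly on $A$. With the convention that $|\Phi(x,p) - \phi(x)| = 0$ when both values are $+\infty$ (and $= +\infty$ when exactly one is), uniform convergence means $e(p) \to 0$ as $p \to p_0$. $\operatorname{dom} e = \{p \in P : e(p) < +\infty\}$. *)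

(* Defs.v *)
From HB Require Import structures.
From mathcomp Require Import all_boot all_order all_algebra.
From mathcomp Require Import all_classical all_reals all_analysis.

Set Implicit Arguments.
Unset Strict Implicit.
Unset Printing Implicit Defensive.

Import Order.TTheory GRing.Theory Num.Theory.
Import numFieldNormedType.Exports.

Local Open Scope classical_set_scope.
Local Open Scope ring_scope.
Local Open Scope ereal_scope.

Section Optimization.
Context {R : realType} {X : Type}.
Implicit Types (h f phi : X -> \bar R) (M A S : set X).

Definition is_global_minimizer h S (x : X) : Prop :=
  S x /\ forall y, S y -> h x <= h y.

Definition attains_global_min h S : Prop := exists x, is_global_minimizer h S x.

Definition bounded_below_on h S : Prop :=
  exists c : R, forall x, S x -> c%:E <= h x.

Definition inf_on h S : \bar R := ereal_inf (h @` S).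

(* The optimal value f^* of: minimize f over M `&` A. *)
Definition optimal_value f M A : \bar R := inf_on f (M `&` A).

Definition is_optimal_solution f M A (x : X) : Prop :=
  is_global_minimizer f (M `&` A) x.

(* g_lambda; the product on \bar R satisfies 0 * +oo = 0, so g_0 = f. *)
Definition penalty_fun f phi (lambda : R) (x : X) : \bar R :=
  f x + lambda%:E * phi x.

Definition exact_parameters f phi M A : set R :=
  [set lambda : R | [/\ (0 <= lambda)%R,
     attains_global_min (penalty_fun f phi lambda) A &
     forall x, is_global_minimizer (penalty_fun f phi lambda) A x <->
               is_optimal_solution f M A x]].

Definition globally_exact f phi M A : Prop := exact_parameters f phi M A !=set0.

(* lambda^*(f, phi) *)
Definition least_exact_parameter f phi M A : \bar R :=
  ereal_inf (EFin @` exact_parameters f phi M A).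

End Optimization.

(* |a - b|, except that it is 0 when both values are +oo: in \bar R,
   +oo - +oo = -oo, so `|+oo - +oo| = +oo. *)
Definition eabs_diff {R : realType} (a b : \bar R) : \bar R :=
  if a == b then 0 else `|a - b|.

Section Approximation.
Context {R : realType} {X : Type}.

(* e(p) *)
Definition approx_error {P : Type} (phi : X -> \bar R) (Phi : X -> P -> \bar R)
    (A : set X) (p : P) : \bar R :=
  ereal_sup [set eabs_diff (Phi x p) (phi x) | x in A].

Record is_approximation {P : metricType R} (phi : X -> \bar R)
    (Phi : X -> P -> \bar R) (A : set X) (p0 : P) : Prop := IsApproximation {
  approx_ge0 : forall x p, 0 <= Phi x p ;
  approx_at : forall x, Phi x p0 = phi x ;
  approx_cvg : approx_error phi Phi A p @[p --> p0] --> (0 : \bar R)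
}.

(* F_lambda *)
Definition approx_penalty_fun {P : Type} (f : X -> \bar R)
    (Phi : X -> P -> \bar R) (lambda : R) (x : X) (p : P) : \bar R :=
  f x + lambda%:E * Phi x p.

End Approximation.

Definition effective_dom {R : realType} {T : Type} (h : T -> \bar R) : set T :=
  [set t | h t < +oo].

(* Main.v *)
(* An error of [e] in the penalty term moves the penalty function by at most
   [lambda * e], hence also its infimum. If [lambda] exceeds some exact parameter,
   monotonicity in [lambda] gives [g_lambda >= f^*] on [A]; comparing
   [F_lambda(x_p, p)] with [g_lambda(x_p)] from below and with the value of
   [F_lambda] at a solution of (P) from above bounds [f x_p]. *)
Require Import Defs.
From HB Require Import structures.
From mathcomp Require Import all_boot all_order all_algebra.
From mathcomp Require Import all_classical all_reals all_analysis.
From mathcomp Require Import lra.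

Set Implicit Arguments.
Unset Strict Implicit.
Unset Printing Implicit Defensive.

Import Order.TTheory GRing.Theory Num.Theory.
Import numFieldNormedType.Exports.

Local Open Scope classical_set_scope.
Local Open Scope ring_scope.
Local Open Scope ereal_scope.

Lemma eabs_diffC (R : realType) (a b : \bar R) : eabs_diff a b = eabs_diff b a.
Proof.
rewrite /eabs_diff eq_sym; case: a b => [a||] [b||] //=.
by rewrite distrC.
Qed.

(** If exactly one of [a], [b] is [+oo], then [eabs_diff a b] is [+oo], against the finite bound; if
    they agree, the bound itself gives [0 <= e]. *)
Lemma eabs_diff_le (R : realType) (a b : \bar R) (e : R) : 0 <= a -> 0 <= b ->
  eabs_diff a b <= e%:E -> a <= b + e%:E.
Proof.
rewrite /eabs_diff; case: eqP => [-> _ b0 e0|_]; first by rewrite leeDl.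
case: a b => [a||] [b||] //= _ _.
by rewrite !lee_fin ler_distl => /andP[].
Qed.

Lemma inf_on_leD (R : realType) (X : Type) (h k : X -> \bar R) (S : set X)
    (r : R) : (forall x, S x -> h x <= k x + r%:E) ->
  inf_on h S <= inf_on k S + r%:E.
Proof.
move=> hk; rewrite -leeBlDr//; apply: le_ereal_inf_tmp => _ [x Sx <-].
rewrite leeBlDr//; apply: le_trans (hk x Sx).
by apply: ereal_inf_lbound; exists x.
Qed.

Lemma inf_on_minimizer (R : realType) (X : Type) (h : X -> \bar R)
    (S : set X) (x : X) : is_global_minimizer h S x -> inf_on h S = h x.
Proof.
move=> [Sx hx]; apply/le_anti/andP; split.
  by apply: ereal_inf_lbound; exists x.
by apply: le_ereal_inf_tmp => _ [y Sy <-]; exact: hx.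
Qed.

(** The signs of [b x] and [r] serve to distribute [lambda] over their sum in [\bar R]. *)
Lemma penalty_fun_leD (R : realType) (X : Type) (f a b : X -> \bar R)
    (lambda r : R) (x : X) : (0 <= lambda)%R -> (0 <= r)%R -> 0 <= b x ->
  a x <= b x + r%:E ->
  penalty_fun f a lambda x <= penalty_fun f b lambda x + (lambda * r)%:E.
Proof.
move=> l0 r0 b0 ab; rewrite /penalty_fun -addeA leeD2l// EFinM.
by rewrite -ge0_muleDr ?lee_fin// lee_wpmul2l ?lee_fin.
Qed.

Lemma penalty_fun_homo (R : realType) (X : Type) (f phi : X -> \bar R)
    (l l' : R) (x : X) : 0 <= phi x -> (l <= l')%R ->
  penalty_fun f phi l x <= penalty_fun f phi l' x.
Proof. by move=> p0 ll; rewrite leeD2l// lee_wpmul2r ?lee_fin. Qed.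

(** A point of [A] keeps the supremum nonnegative; over the empty set it would be [-oo]. *)
Lemma approx_error_fin (R : realType) (X P : Type) (phi : X -> \bar R)
    (Phi : X -> P -> \bar R) (A : set X) (p : P) : A !=set0 ->
  effective_dom (approx_error phi Phi A) p ->
  exists2 e : R, (0 <= e)%R & approx_error phi Phi A p = e%:E.
Proof.
move=> [a Aa] ltey.
have e0 : 0 <= approx_error phi Phi A p.
  apply: (@le_trans _ _ (eabs_diff (Phi a p) (phi a))).
    by rewrite /eabs_diff; case: ifP.
  by apply: ereal_sup_ubound; exists a.
have ef : approx_error phi Phi A p \is a fin_num by rewrite ge0_fin_numE.
by exists (fine (approx_error phi Phi A p)); rewrite ?fine_ge0 ?fineK.
Qed.

Lemma penalty_fun_approx (R : realType) (X P : Type) (f phi : X -> \bar R)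
    (Phi : X -> P -> \bar R) (A : set X) (p : P) (lambda e : R) (x : X) :
  (forall y, 0 <= phi y) -> (forall y q, 0 <= Phi y q) -> (0 <= lambda)%R ->
  (0 <= e)%R -> approx_error phi Phi A p = e%:E -> A x ->
  approx_penalty_fun f Phi lambda x p
    <= penalty_fun f phi lambda x + (lambda * e)%:E /\
  penalty_fun f phi lambda x
    <= approx_penalty_fun f Phi lambda x p + (lambda * e)%:E.
Proof.
move=> phi0 Phi0 l0 e0 eE Ax.
have de : eabs_diff (Phi x p) (phi x) <= e%:E.
  by rewrite -eE; apply: ereal_sup_ubound; exists x.
split.
  apply: (@penalty_fun_leD _ _ f (Phi ^~ p) phi) => //.
  exact: eabs_diff_le.
apply: (@penalty_fun_leD _ _ f phi (Phi ^~ p)) => //.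
by apply: eabs_diff_le => //; rewrite eabs_diffC.
Qed.

Theorem proposition5p3 (R : realType) (X P : metricType R) (M A : set X)
    (f phi : X -> \bar R) (Phi : X -> P -> \bar R) (p0 : P)
    (M_neq0 : M !=set0) (A_neq0 : A !=set0)
    (f_gtNy : forall x, f x != -oo)
    (f_attains : attains_global_min f (M `&` A))
    (fstar_fin : optimal_value f M A \is a fin_num)
    (phi_ge0 : forall x, 0 <= phi x)
    (phi_eq0 : forall x, phi x = 0 <-> M x)
    (Phi_approx : is_approximation phi Phi A p0)
    (lambda0 : R) (lambda0_ge0 : (0 <= lambda0)%R)
    (g_bounded : bounded_below_on (penalty_fun f phi lambda0) A) :
  (forall (lambda : R) (p : P), (lambda0 <= lambda)%R ->
     effective_dom (approx_error phi Phi A) p ->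
     `| inf_on (approx_penalty_fun f Phi lambda ^~ p) A
        - inf_on (penalty_fun f phi lambda) A |
       <= lambda%:E * approx_error phi Phi A p) /\
  (globally_exact f phi M A ->
   forall (lambda : R) (p : P), least_exact_parameter f phi M A < lambda%:E ->
     effective_dom (approx_error phi Phi A) p ->
     attains_global_min (approx_penalty_fun f Phi lambda ^~ p) A ->
     forall x_p, is_global_minimizer (approx_penalty_fun f Phi lambda ^~ p) A x_p ->
     `| optimal_value f M A - f x_p |
       <= lambda%:E * (approx_error phi Phi A p + Phi x_p p)).
Proof.
have [xs xs_min] := f_attains; have [[Mxs Axs] _] := xs_min.
have fxsE : optimal_value f M A = f xs by exact: inf_on_minimizer.
(* The penalty term vanishes at the feasible point [xs], whatever the parameter. *)
have gxsE l : penalty_fun f phi l xs = f xs.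
  by rewrite /penalty_fun (phi_eq0 xs).2// mule0 adde0.
rewrite fxsE in fstar_fin *.
have Phi0 := approx_ge0 Phi_approx.
split=> [l p l0l dom|_ l p].
  have [e e0 eE] := approx_error_fin A_neq0 dom.
  have l_ge0 : (0 <= l)%R by exact: le_trans l0l.
  have [c gc] := g_bounded.
  have approx x :=
    @penalty_fun_approx _ _ _ f _ _ _ _ _ _ x phi_ge0 Phi0 l_ge0 e0 eE.
  have Fg := inf_on_leD (fun x Ax => (approx x Ax).1).
  have gF := inf_on_leD (fun x Ax => (approx x Ax).2).
  rewrite eE -EFinM.
  (* Bounded below by [c], since the penalty function grows from [lambda0] to [l], and above by its
     value at [xs]. *)
  have g_fin : inf_on (penalty_fun f phi l) A \is a fin_num.
    rewrite fin_numElt; apply/andP; split.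
      apply: (@lt_le_trans _ _ c%:E); first exact: ltNyr.
      apply: le_ereal_inf_tmp => _ [x Ax <-]; apply: le_trans (gc x Ax) _.
      exact: penalty_fun_homo.
    apply: (@le_lt_trans _ _ (f xs)); last by rewrite ltey_eq fstar_fin.
    by rewrite -(gxsE l); apply: ereal_inf_lbound; exists xs.
  move: Fg gF; rewrite -(fineK g_fin).
  (* The two-sided comparison with a finite infimum rules out an infinite [F]. *)
  move: (inf_on _ A) => [F||] //=; rewrite !lee_fin => Fg gF.
  by rewrite ler_distl; apply/andP; split; lra.
(* Exactness is used only at some [l' < l], supplied by the infimum lying strictly below [l]. *)
move=> /ereal_inf_lt[_ [l' [l'_ge0 _ exact_l'] <-]]; rewrite lte_fin => l'l dom _ xp [Axp xp_min].
have [e e0 eE] := approx_error_fin A_neq0 dom.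
have l_gt0 : (0 < l)%R by exact: le_lt_trans l'l.
have [_ xs_min'] : is_global_minimizer (penalty_fun f phi l') A xs.
  exact/exact_l'.
have [_ gF] := penalty_fun_approx f phi_ge0 Phi0 (ltW l_gt0) e0 eE Axp.
have [Fg _] := penalty_fun_approx f phi_ge0 Phi0 (ltW l_gt0) e0 eE Axs.
(* With g for [penalty_fun f phi]: [f xs] = g_l'([xs]) <= g_l'([xp]) <= g_l([xp]), and the last is
   within [l * e] of the approximate penalty function. *)
have lower : f xs <= approx_penalty_fun f Phi l xp p + (l * e)%:E.
  apply: le_trans gF; rewrite -(gxsE l'); apply: le_trans (xs_min' xp Axp) _.
  by apply: penalty_fun_homo => //; exact: ltW.
have upper : approx_penalty_fun f Phi l xp p <= f xs + (l * e)%:E.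
  by apply: le_trans (xp_min xs Axs) _; rewrite -(gxsE l).
rewrite eE; move: lower upper; rewrite /approx_penalty_fun.
move: (f_gtNy xp) (Phi0 xp p) fstar_fin.
(* By [upper], neither [f xp] nor [Phi xp p] is [+oo]; for the latter [0 < l] is essential, as
   [0 * +oo = 0]. *)
case: (f xs) => [s||] //; case: (f xp) => [u||] // _;
  case: (Phi xp p) => [v||] // v0 _; rewrite ?gt0_muley ?lte_fin//.
rewrite -EFinM -!EFinD abse_EFin -EFinM !lee_fin in v0 * => lower upper.
have lv0 : (0 <= l * v)%R by rewrite mulr_ge0// ltW.
(* [lower] bounds [s - u] by [l * e + l * v]; [upper] bounds [u - s] by [l * e - l * v], which is no
   larger. *)
by rewrite mulrDr ler_distl; apply/andP; split; lra.
Qed.
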